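(* For all integers $n,p,m\ge 0$ (and $k\ge1$), the numbers $H_{n,p}(m)$ defined below satisfy \[ H_{n+1,p}(m)=\frac{l\,(p+1)\,(p+a+m)^{k}}{(p+a+m+1)^{k}}\,H_{n,p+1}(m)-pq\,H_{n,p}(m), \] and $H_{0,p}(m)=\dfrac{l^{a}}{a^{k}}$ for all $p\ge 0$.
   Context: Let $k\ge1$ be an integer, let $a,q,l_1,\dots,l_k$ be nonzero reals, $L=(l_1,\dots,l_k)$, $l=\prod_{i=1}^k l_i$; denominators $a+j$ ($j\ge0$ integer) are assumed nonzero and $l^{a+i}$ means $l^a l^i$. Let $s(n,i)$ be the signed Stirling numbers of the first kind ($\frac{1}{i!}(\ln(1+x))^i=\sum_{n\ge i}s(n,i)\frac{x^n}{n!}$) and $\left\{ {n \atop i} \right\}$ the Stirling numbers of the second kind. For integers $n,m\ge0$ define the generalized $m$-poly-Bernoulli numbers \[ \mathcal{B}_{n,m}^{(k)}(a,q,L)=\frac{(a+m)^k}{a^k}\sum_{i=0}^{n}\frac{i!\,(-q)^{n-i}\,l^{i+a}}{(a+m+i)^k}\left\{ {n \atop i} \right\}, \] and for integers $n,p,m\ge0$ \[ H_{n,p}(m)=\frac{1}{p!\,l^{p}}\Big(\frac{p+a+m}{a+m}\Big)^{k}\sum_{i=0}^{p}s(p,i)(-q)^{p-i}\mathcal{B}_{n+i,m}^{(k)}(a,q,L). \] *)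

(* Defs.v *)
From HB Require Import structures.
From mathcomp Require Import all_boot all_order all_algebra.
From mathcomp Require Import reals sequences exp trigo.
From mathcomp Require Import complex.

Set Implicit Arguments.
Unset Strict Implicit.
Unset Printing Implicit Defensive.

Import GRing.Theory Num.Theory.

Local Open Scope ring_scope.
Local Open Scope complex_scope.

(* The Taylor polynomial of order n of ln(1+x) at 0. *)
Definition ln1p_trunc (R : realType) (n : nat) : {poly R} :=
  \sum_(1 <= j < n.+1) ((-1) ^+ j.-1 / j%:R) *: 'X^j.

(* n! times the coefficient of x^n in the power series (ln(1+x))^i / i!;
   terms of ln(1+x) of degree > n do not contribute to that coefficient. *)
Definition stirling1 (R : realType) (n i : nat) : R :=
  n`!%:R * ((i`!%:R)^-1 *: ln1p_trunc R n ^+ i)`_n.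

(* The number of partitions of an n-element set into i nonempty blocks
   ([partition] excludes the empty block). *)
Definition stirling2 (n i : nat) : nat :=
  #|[set P : {set {set 'I_n}} | partition P [set: 'I_n] & #|P| == i]|.

Definition cexp (R : realType) (z : R[i]) : R[i] :=
  (expR (complex.Re z) * cos (complex.Im z)) +i* (expR (complex.Re z) * sin (complex.Im z)).

Definition lprod (R : realType) (k : nat) (L : 'I_k -> R) : R :=
  \prod_(i < k) L i.

(* Since l may be negative, l^a is complex in general and depends on the
   choice of a logarithm w of l (cexp w = l): l^a := exp(a w).  If l > 0 and
   w = ln l this is the usual real power. *)
Definition cpow (R : realType) (w : R[i]) (a : R) : R[i] := cexp (a%:C * w).

Definition polyB (R : realType) (k : nat) (a q : R) (L : 'I_k -> R) (w : R[i])
    (n m : nat) : R[i] :=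
  ((a + m%:R) ^+ k / a ^+ k)%:C *
  \sum_(i < n.+1)
    (i`!%:R * (- q) ^+ (n - i))%:C * (cpow w a * (lprod L ^+ i)%:C)
      / ((a + m%:R + i%:R) ^+ k)%:C * (stirling2 n i)%:R.

Definition polyH (R : realType) (k : nat) (a q : R) (L : 'I_k -> R) (w : R[i])
    (n p m : nat) : R[i] :=
  ((p`!%:R * lprod L ^+ p)^-1 * ((p%:R + a + m%:R) / (a + m%:R)) ^+ k)%:C *
  \sum_(i < p.+1)
    (stirling1 R p i * (- q) ^+ (p - i))%:C * polyB a q L w (n + i) m.

(* Main.v *)
Require Import Defs.
From HB Require Import structures.
From mathcomp Require Import all_boot all_order all_algebra.
From mathcomp Require Import reals sequences exp trigo.
From mathcomp Require Import complex.
From mathcomp Require Import ring.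

(* Writing A(n,p) for the sum defining H_{n,p}(m), the recurrence
   s(p+1,i+1) = s(p,i) - p s(p,i+1) gives A(n,p+1) = A(n+1,p) + p q A(n,p),
   which is the claimed recurrence after rescaling.  For the initial value, the
   sequence B_n is the image of the explicit sequence
   f(j) = ((a+m)/a)^k j! l^(j+a) / (a+m+j)^k under the (-q)-scaled Stirling
   transform of the second kind, and A(0,_) applies the inverse transform, so
   A(0,p) = f(p).  The recurrence of s(n,i) is read off from
   (1+x) ((ln(1+x))^(i+1))' = (i+1) (ln(1+x))^i; the recurrence of the Stirling
   numbers of the second kind is the usual insertion of one point into a set
   partition. *)

Import GRing.Theory Num.Theory.

(** * Stirling numbers of the second kind: set partitions and insertion of a point *)

Fixpoint stirling2_rec (n i : nat) : nat :=
  match n, i with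
  | 0, 0 => 1
  | 0, _.+1 => 0
  | _.+1, 0 => 0
  | n'.+1, i'.+1 => stirling2_rec n' i' + i'.+1 * stirling2_rec n' i'.+1
  end.

Section PartitionInsert.

Variables (T : finType) (x : T) (D : {set T}).
Hypothesis xD : x \notin D.

(* Adding [x] to the marked block [B] of [Q]; the mark [B = set0] stands for
   making [x] a singleton block. *)
Definition partition_insert (QB : {set {set T}} * {set T}) : {set {set T}} :=
  (x |: QB.2) |: (QB.1 :\ QB.2).

Let markable (Q : {set {set T}}) (B : {set T}) :=
  partition Q D && (B \in set0 |: Q).

Let markable_sub Q B : markable Q B -> B \subset D.
Proof.
by case/andP=> pQ /setU1P[->|BQ]; rewrite ?sub0set ?(partitionS pQ).
Qed.

Let markable_notin Q B : markable Q B -> x \notin B.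
Proof. by move/markable_sub/subsetP=> sBD; apply: contra xD => /sBD. Qed.

Let markable_partition Q B : markable Q B -> partition (Q :\ B) (D :\: B).
Proof.
case/andP=> pQ /setU1P[->|BQ]; last exact: partitionD1.
rewrite setD0; suff -> : Q :\ set0 = Q by [].
by apply/setP=> A; rewrite !inE; case: eqP => // ->; rewrite (partition0 pQ).
Qed.

Let markable_new Q B : markable Q B -> x |: B \notin Q :\ B.
Proof.
move=> mQB; apply/negP => xBQ.
have /subsetP/(_ x) := partitionS (markable_partition _ _ mQB) xBQ.
by rewrite setU11 inE (negbTE xD) andbF => /(_ isT).
Qed.

Lemma partition_insertP Q B : partition Q D -> B \in set0 |: Q ->
  partition (partition_insert (Q, B)) (x |: D).
Proof.
move=> pQ BQ; have mQB : markable Q B by apply/andP.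
(* In this form the new partition is a partition of [D :\: B] with the single block [x |: B]
   added. *)
have -> : x |: D = (x |: B) :|: (D :\: B).
  rewrite -setUA -{1}(setID D B).
  by rewrite (setIidPr (markable_sub _ _ mQB)).
apply: partitionU1; first exact: markable_partition.
  by apply/set0Pn; exists x; rewrite setU11.
rewrite -setI_eq0; apply/eqP/setP=> y; rewrite !inE.
by case: eqP => [->|_] /=; [rewrite (negbTE xD) !andbF | case: (y \in B)].
Qed.

Lemma card_partition_insert Q B : partition Q D -> B \in set0 |: Q ->
  #|partition_insert (Q, B)| = #|Q| + (B == set0).
Proof.
move=> pQ BQ; have mQB : markable Q B by apply/andP.
rewrite cardsU1 markable_new //= (cardsD1 B Q).
case/setU1P: BQ => [->|BQ]; first by rewrite (partition0 pQ) eqxx addnC.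
by rewrite BQ (negbTE (partition_neq0 pQ BQ)) addn0.
Qed.

(** The block containing [x] is [x |: B], so deleting [x] from it recovers the mark; the other
    blocks are [Q :\ B], which then determine [Q]. *)
Lemma partition_insert_inj Q Q' B B' :
  partition Q D -> B \in set0 |: Q -> partition Q' D -> B' \in set0 |: Q' ->
  partition_insert (Q, B) = partition_insert (Q', B') -> (Q, B) = (Q', B').
Proof.
move=> pQ BQ pQ' BQ' eqf.
have mQB : markable Q B by apply/andP.
have mQB' : markable Q' B' by apply/andP.
have pbl R C : partition R D -> C \in set0 |: R ->
  pblock (partition_insert (R, C)) x = x |: C.
  move=> pR CR; apply: def_pblock; last exact: setU11.
    exact: partition_trivIset (partition_insertP _ _ pR CR).
  exact: setU11.
have eqxB : x |: B = x |: B' by rewrite -(pbl Q) // -(pbl Q') // eqf.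
have eqB : B = B'.
  rewrite -(setU1K (markable_notin _ _ mQB)) eqxB.
  by rewrite (setU1K (markable_notin _ _ mQB')).
subst B'; congr pair.
have eqD : Q :\ B = Q' :\ B.
  rewrite -(setU1K (markable_new _ _ mQB)) -(setU1K (markable_new _ _ mQB')).
  by rewrite /partition_insert /= in eqf; rewrite eqf.
(* An empty mark is not a block, so removing it changes neither partition; a nonempty mark is a
   block of both and is put back. *)
have [B0|B0] := eqVneq B set0.
  apply/setP=> A; move/setP/(_ A): eqD; rewrite !inE B0.
  by case: eqP => //= -> _; rewrite (partition0 pQ) (partition0 pQ').
move: BQ BQ'; rewrite !inE (negbTE B0) /= => BQ BQ'.
by rewrite -(setD1K BQ) -(setD1K BQ') eqD.
Qed.

(** Take the block [C] of [x] and delete [x] from it: what remains is the mark, which is empty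
    exactly when [x] was a singleton block. *)
Lemma partition_insert_surj P : partition P (x |: D) ->
  exists Q B, [/\ partition Q D, B \in set0 |: Q & P = partition_insert (Q, B)].
Proof.
move=> pP; have xP : x \in cover P by rewrite (cover_partition pP) setU11.
pose C := pblock P x; have CP : C \in P by exact: pblock_mem.
have xC : x \in C by rewrite mem_pblock.
have pPC := partitionD1 pP CP.
have sC : C :\ x \subset D.
  apply/subsetP=> y /setD1P[yx /(subsetP (partitionS pP CP))].
  by rewrite !inE (negbTE yx).
have DC : (x |: D) :\: C = D :\: (C :\ x).
  apply/setP=> y; rewrite !inE; case: (eqVneq y x) => [->|] //=.
  by rewrite xC (negbTE xD).
(* Were it another block, it would be nonempty and yet disjoint from [C]. *)
have CPC : C :\ x \notin P :\ C.
  apply/negP=> CxP; have /set0Pn[y yC] := partition_neq0 pPC CxP.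
  move/subsetP/(_ y yC): (partitionS pPC CxP).
  by rewrite DC inE yC.
have [C0|C0] := eqVneq (C :\ x) set0.
  exists (P :\ C), set0; split; rewrite ?setU11 //.
    by rewrite DC C0 setD0 in pPC.
  rewrite /partition_insert /= -{1}(setD1K CP); congr (_ |: _).
    by rewrite -{1}(setD1K xC) C0.
  apply/setP=> A; rewrite !inE; case: (eqVneq A set0) => // ->.
  by rewrite (partition0 pP) andbF.
exists ((C :\ x) |: (P :\ C)), (C :\ x); split.
- rewrite DC in pPC; have -> : D = (C :\ x) :|: (D :\: (C :\ x)).
    by rewrite -{1}(setID D (C :\ x)) (setIidPr sC).
  by apply: partitionU1 => //; rewrite -setI_eq0 setIDA setD_eq0 subsetIl.
- by rewrite inE setU11 orbT.
- by rewrite /partition_insert /= setD1K // setU1K // setD1K.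
Qed.

(** Insertion is a bijection from marked partitions of [D]. To reach [i.+1] blocks, either the mark
    is empty and [Q] has [i] blocks ([A1]), or [Q] has [i.+1] blocks and the mark is one of them
    ([A2]). *)
Lemma card_partitions_insert i :
  #|[set P : {set {set T}} | partition P (x |: D) & #|P| == i.+1]| =
  #|[set P : {set {set T}} | partition P D & #|P| == i]|
  + i.+1 * #|[set P : {set {set T}} | partition P D & #|P| == i.+1]|.
Proof.
set S := [set P | partition P D & #|P| == i].
set S' := [set P | partition P D & #|P| == i.+1].
pose A1 := [set (Q, set0 : {set T}) | Q in S].
pose A2 := [set QB : {set {set T}} * {set T} | (QB.1 \in S') && (QB.2 \in QB.1)].
have dA : A1 :&: A2 = set0.
  apply/setP=> -[Q B]; rewrite !inE /=; apply/negP=> /andP[/imsetP[Q' _ [-> ->]]].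
  by case/andP=> /andP[pQ _]; rewrite (partition0 pQ).
have okA Q B : (Q, B) \in A1 :|: A2 ->
    [/\ partition Q D, B \in set0 |: Q & #|Q| + (B == set0) = i.+1].
  case/setUP=> [/imsetP[Q' ]|]; rewrite !inE /=.
    by case/andP=> pQ /eqP cQ [-> ->]; rewrite eqxx cQ addn1.
  case/andP=> /andP[pQ /eqP cQ] BQ.
  by rewrite BQ orbT (negbTE (partition_neq0 pQ BQ)) addn0.
have -> : [set P | partition P (x |: D) & #|P| == i.+1] =
    partition_insert @: (A1 :|: A2).
  apply/setP=> P; rewrite inE; apply/andP/imsetP.
    case=> /partition_insert_surj[Q [B [pQ BQ ->]]].
    rewrite card_partition_insert // => cQ; exists (Q, B) => //.
    case/setU1P: (BQ) => [B0|BQ'].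
      apply/setUP; left; apply/imsetP; exists Q; last by rewrite B0.
      by move: cQ; rewrite inE pQ B0 eqxx addn1 eqSS.
    apply/setUP; right; rewrite !inE /= pQ BQ' andbT.
    by rewrite (negbTE (partition_neq0 pQ BQ')) addn0 in cQ.
  case=> -[Q B] /okA[pQ BQ cQ] ->.
  by rewrite card_partition_insert // cQ eqxx partition_insertP.
rewrite card_in_imset; last first.
  by move=> [Q B] [Q' B'] /okA[? ? _] /okA[? ? _]; apply: partition_insert_inj.
rewrite cardsU dA cards0 subn0; congr (_ + _).
  by rewrite card_imset // => Q Q' [].
rewrite -sum1_card; under eq_bigl => QB do rewrite inE.
rewrite -(pair_big_dep (mem S') (fun Q => mem Q) (fun _ _ => 1)) /=.
under eq_bigr => Q /[1!inE] /andP[_ /eqP cQ] do rewrite sum1_card cQ.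
by rewrite sum_nat_const mulnC.
Qed.

End PartitionInsert.

(** The ground set is an arbitrary [D] inside a fixed type so that the induction can delete a point
    from it. *)
Lemma card_partitions (T : finType) (D : {set T}) i :
  #|[set P : {set {set T}} | partition P D & #|P| == i]| = stirling2_rec #|D| i.
Proof.
move cD: #|D| => n; elim: n D cD i => [|n IH] D cD i.
  have -> : [set P : {set {set T}} | partition P D & #|P| == i] =
            if i == 0 then [set set0] else set0.
    apply/setP=> P; rewrite inE (cards0_eq cD) partition_set0.
    case: eqP => [->|P0].
      by rewrite cards0 eq_sym; case: eqP; rewrite !inE ?eqxx.
    by case: i => [|i] /=; rewrite !inE //; apply/esym/eqP.
  by case: i => [|i] /=; rewrite ?cards1 ?cards0.
have /card_gt0P[x xD] : 0 < #|D| by rewrite cD.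
have cDx : #|D :\ x| = n by move: cD; rewrite (cardsD1 x) xD add1n => -[].
rewrite -(setD1K xD); case: i => [|i] /=.
  apply/eqP; rewrite cards_eq0; apply/eqP/setP=> P; rewrite !inE.
  apply/negP=> /andP[pP /eqP/cards0_eq P0]; move: (cover_partition pP).
  by rewrite P0 /cover big_set0 => /setP/(_ x); rewrite !inE eqxx.
by rewrite card_partitions_insert ?setD11 // !(IH _ cDx).
Qed.

Lemma stirling2E n i : stirling2 n i = stirling2_rec n i.
Proof. by rewrite /stirling2 card_partitions cardsT card_ord. Qed.

Lemma stirling2SS n i :
  stirling2 n.+1 i.+1 = (stirling2 n i + i.+1 * stirling2 n i.+1)%N.
Proof. by rewrite !stirling2E. Qed.

Lemma stirling2_small n i : (n < i)%N -> stirling2 n i = 0%N.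
Proof.
rewrite stirling2E; elim: n i => [|n IH] [|i] //= lt_ni.
by rewrite !IH ?muln0 // ltnW.
Qed.

Local Open Scope ring_scope.
Local Open Scope complex_scope.

(** * Stirling numbers of the first kind: coefficients of powers of the logarithm *)

Lemma ln1p_truncS (R : realType) n :
  ln1p_trunc R n.+1 = ln1p_trunc R n + ((-1) ^+ n / n.+1%:R) *: 'X^(n.+1).
Proof. by rewrite /ln1p_trunc big_nat_recr. Qed.

(** Without constant term, the [i]-th power starts in degree [i]; this makes s(n,i) vanish for n <
    i. *)
Lemma dvdX_ln1p_trunc (R : realType) n : exists Q, ln1p_trunc R n = 'X * Q.
Proof.
elim: n => [|n [Q IH]]; first by exists 0; rewrite /ln1p_trunc big_geq // mulr0.
exists (Q + ((-1) ^+ n / n.+1%:R) *: 'X^n).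
by rewrite ln1p_truncS IH mulrDr exprS scalerAr.
Qed.

(** The derivative is the finite geometric sum of powers of [- 'X]. The error term has degree [n],
    so it is invisible in lower coefficients. *)
Lemma deriv_ln1p_trunc (R : realType) n :
  (1 + 'X) * (ln1p_trunc R n)^`() = 1 - (- 'X) ^+ n.
Proof.
elim: n => [|n IH].
  by rewrite /ln1p_trunc big_geq // deriv0 mulr0 expr0 subrr.
rewrite ln1p_truncS derivD derivZ derivXn mulrDr IH /= -scaler_nat scalerA.
rewrite divfK ?pnatr_eq0 // -mul_polyC rmorphXn /= polyCN polyC1.
rewrite -exprMn mulN1r exprS.
by ring.
Qed.

(** The two truncations differ by a multiple of ['X^(n.+1)], hence so do their powers. *)
Lemma coef_ln1p_truncS_exp (R : realType) n i :
  (ln1p_trunc R n.+1 ^+ i)`_n = (ln1p_trunc R n ^+ i)`_n.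
Proof.
apply/eqP; rewrite -subr_eq0 -coefB subrXX ln1p_truncS [_ + _ *: _]addrC addrK.
by rewrite -scalerAl coefZ coefXnM ltnSn mulr0.
Qed.

Lemma stirling1SS (R : realType) n i :
  stirling1 R n.+1 i.+1 = stirling1 R n i - n%:R * stirling1 R n i.+1.
Proof.
have h : n.+1%:R * (ln1p_trunc R n.+1 ^+ i.+1)`_n.+1
         + n%:R * (ln1p_trunc R n ^+ i.+1)`_n
         = i.+1%:R * (ln1p_trunc R n ^+ i)`_n.
  (* All three coefficients are now read from the truncation of order [n.+1], whose error in the
     differential equation starts beyond degree [n]; comparing coefficients of degree [n] gives
     [h]. *)
  rewrite -(coef_ln1p_truncS_exp R n i) -(coef_ln1p_truncS_exp R n i.+1); set P := ln1p_trunc R n.+1.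
  have : (1 + 'X) * (P ^+ i.+1)^`() = P ^+ i *+ i.+1 * (1 - (- 'X) ^+ n.+1).
    by rewrite -deriv_ln1p_trunc deriv_exp /= -/P; ring.
  move/(congr1 (fun p : {poly R} => p`_n)); rewrite mulrDl mul1r coefD coef_deriv coefXM.
  rewrite mulrBr mulr1 exprNn mulrA coefB coefMXn ltnSn subr0 coefMn.
  rewrite !mulr_natl => <-; congr (_ + _).
  by case: (n) => [|r] /=; rewrite ?mulr0n // coef_deriv.
rewrite /stirling1 !coefZ !factS !natrM.
have f0 j : j`!%:R != 0 :> R by rewrite pnatr_eq0 -lt0n fact_gt0.
have i0 : i.+1%:R != 0 :> R by rewrite pnatr_eq0.
apply: (mulfI i0); apply: (mulfI (f0 i)).
move: h; set x := nth _ _ n.+1; set y := nth _ (polyseq (_ ^+ i.+1)) n.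
set z := nth _ _ n => h.
(* Multiplication by (i+1)! has cleared the denominators, leaving n! times the identity [h]. *)
transitivity (n`!%:R * (n.+1%:R * x)).
  by field; rewrite f0 nat1r pnatr_eq0.
have -> : n.+1%:R * x = i.+1%:R * z - n%:R * y by rewrite -h addrK.
by field; rewrite f0 nat1r pnatr_eq0.
Qed.

Lemma stirling1_small (R : realType) n i : (n < i)%N -> stirling1 R n i = 0.
Proof.
move=> lt_ni; have [Q PQ] := dvdX_ln1p_trunc R n.
by rewrite /stirling1 PQ coefZ exprMn coefXnM lt_ni !mulr0.
Qed.

Lemma stirling1_00 (R : realType) : stirling1 R 0 0 = 1.
Proof. by rewrite /stirling1 expr0 coefZ coef1 fact0 invr1 !mulr1. Qed.

Lemma stirling1_S0 (R : realType) n : stirling1 R n.+1 0 = 0.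
Proof. by rewrite /stirling1 expr0 coefZ coef1 !mulr0. Qed.

(** * Scaled Stirling transforms and their inversion *)

Section Transforms.

Variables (R : realType) (x : R[i]).
Implicit Types (u v f : nat -> R[i]).

Definition stirling1_transform u p : R[i] :=
  \sum_(i < p.+1) (stirling1 R p i)%:C * x ^+ (p - i) * u i.

Definition stirling2_transform f n : R[i] :=
  \sum_(j < n.+1) x ^+ (n - j) * (stirling2 n j)%:R * f j.

Lemma eq_stirling1_transform u v p :
  u =1 v -> stirling1_transform u p = stirling1_transform v p.
Proof. by move=> uv; apply: eq_bigr => i _; rewrite uv. Qed.

Lemma stirling1_transform_linear c u v p :
  stirling1_transform (fun n => u n + c * v n) p =
  stirling1_transform u p + c * stirling1_transform v p.
Proof.
rewrite /stirling1_transform mulr_sumr -big_split; apply: eq_bigr => i _ /=.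
by ring.
Qed.

Lemma stirling1_transformS u p :
  stirling1_transform u p.+1 =
  stirling1_transform (fun n => u n.+1) p - p%:R * x * stirling1_transform u p.
Proof.
rewrite /stirling1_transform big_ord_recl /= stirling1_S0 rmorph0 !mul0r add0r.
transitivity (\sum_(i < p.+1) ((stirling1 R p i)%:C * x ^+ (p - i) * u i.+1
   - p%:R * ((stirling1 R p i.+1)%:C * x ^+ (p - i) * u i.+1))).
  apply: eq_bigr => i _; rewrite /bump /= add1n subSS stirling1SS.
  move: (stirling1 R p i) (stirling1 R p i.+1) => s t.
  by rewrite rmorphB rmorphM rmorph_nat /=; ring.
rewrite sumrB; congr (_ - _).
(* The index shift is matched at both ends: the last term vanishes as s(p,p+1) = 0, and the first
   term opposite as p s(p,0) = 0, including p = 0. *)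
rewrite big_ord_recr /= stirling1_small // rmorph0 !(mul0r, mulr0) addr0.
rewrite big_ord_recl mulrDr /= subn0.
have -> : p%:R * x * ((stirling1 R p 0)%:C * x ^+ p * u 0%N) = 0.
  by case: (p) => [|r]; rewrite ?stirling1_S0 ?rmorph0 !(mul0r, mulr0).
rewrite add0r mulr_sumr; apply: eq_bigr => i _.
by rewrite /bump /= add1n -(subnSK (ltn_ord i)) exprS; ring.
Qed.

(** The factor [i.+1] of the triangular recurrence is the argument of [f] in the same term, so it is
    absorbed into [f] as the weight [j]. *)
Lemma stirling2_transformS f n :
  stirling2_transform f n.+1 =
  stirling2_transform (fun j => f j.+1) n
  + x * stirling2_transform (fun j => j%:R * f j) n.
Proof.
rewrite /stirling2_transform big_ord_recl /= stirling2E /= mulr0 mul0r add0r.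
transitivity (\sum_(i < n.+1) (x ^+ (n - i) * (stirling2 n i)%:R * f i.+1
   + x ^+ (n - i) * (stirling2 n i.+1)%:R * (i.+1%:R * f i.+1))).
  apply: eq_bigr => i _; rewrite /bump /= add1n subSS stirling2SS natrD natrM.
  by ring.
rewrite big_split /=; congr (_ + _).
rewrite big_ord_recr /= stirling2_small // !(mul0r, mulr0) addr0.
rewrite big_ord_recl /= mul0r mulr0 add0r mulr_sumr; apply: eq_bigr => i _.
by rewrite /bump /= add1n -(subnSK (ltn_ord i)) exprS; ring.
Qed.

(** Induction on [p] for all [f] at once: the two recurrences turn the value at [p.+1] into f(p+1) +
    x p f(p) - p x f(p). *)
Lemma stirling_inversion f p :
  stirling1_transform (stirling2_transform f) p = f p.
Proof.
elim: p f => [|p IH] f.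
  rewrite /stirling1_transform /stirling2_transform !big_ord1 stirling1_00.
  by rewrite stirling2E /= rmorph1 !mul1r.
rewrite stirling1_transformS IH.
rewrite (eq_stirling1_transform _ _ p (stirling2_transformS f)).
by rewrite stirling1_transform_linear !IH; ring.
Qed.

End Transforms.

(** * The recurrence and initial value of H *)

Section PolyBernoulli.

Variables (R : realType) (k : nat) (a q : R) (L : 'I_k -> R) (w : R[i]).

Let real_complexMX (c : R) e : (c * (- q) ^+ e)%:C = c%:C * (- q%:C) ^+ e.
Proof. by rewrite rmorphM rmorphXn rmorphN. Qed.

Let coefB m j : R[i] :=
  ((a + m%:R) ^+ k / a ^+ k)%:C *
  ((j`!%:R)%:C * (cpow w a * (lprod L ^+ j)%:C) / ((a + m%:R + j%:R) ^+ k)%:C).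

Lemma polyB_transform n m :
  polyB a q L w n m = stirling2_transform R (- q%:C) (coefB m) n.
Proof.
rewrite /polyB /stirling2_transform mulr_sumr; apply: eq_bigr => i _.
by rewrite real_complexMX /coefB; ring.
Qed.

Lemma polyH_transform n p m :
  polyH a q L w n p m =
  ((p`!%:R * lprod L ^+ p)^-1 * ((p%:R + a + m%:R) / (a + m%:R)) ^+ k)%:C *
  stirling1_transform R (- q%:C) (fun i => polyB a q L w (n + i) m) p.
Proof.
rewrite /polyH; congr (_ * _); apply: eq_bigr => i _.
by rewrite real_complexMX.
Qed.

Hypotheses (lprod_neq0 : lprod L != 0) (haj : forall j : nat, a + j%:R != 0).

Let shift_neq0 p m : p%:R + a + m%:R != 0.
Proof. by rewrite [p%:R + a]addrC -addrA -natrD. Qed.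

Lemma polyH_rec n p m :
  polyH a q L w n.+1 p m =
    (lprod L * p.+1%:R * (p%:R + a + m%:R) ^+ k
       / (p%:R + a + m%:R + 1) ^+ k)%:C * polyH a q L w n p.+1 m
    - (p%:R * q)%:C * polyH a q L w n p m.
Proof.
rewrite !polyH_transform stirling1_transformS.
have -> : stirling1_transform R (- q%:C) (fun i => polyB a q L w (n.+1 + i) m) p
        = stirling1_transform R (- q%:C) (fun i => polyB a q L w (n + i.+1) m) p.
  by apply: eq_stirling1_transform => i; rewrite addSnnS.
(* The coefficient in the recurrence is exactly the ratio of the normalising factors at [p] and
   [p.+1], so only the recurrence of the transform remains. *)
have -> : ((p`!%:R * lprod L ^+ p)^-1 * ((p%:R + a + m%:R) / (a + m%:R)) ^+ k)%:C
  = (lprod L * p.+1%:R * (p%:R + a + m%:R) ^+ k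
       / (p%:R + a + m%:R + 1) ^+ k)%:C *
    ((p.+1`!%:R * lprod L ^+ p.+1)^-1
       * ((p.+1%:R + a + m%:R) / (a + m%:R)) ^+ k)%:C.
  rewrite -rmorphM; congr (_%:C).
  have -> : p%:R + a + m%:R + 1 = p.+1%:R + a + m%:R by rewrite -natr1; ring.
  have := shift_neq0 p.+1 m; have := shift_neq0 p m.
  set y := p.+1%:R + _ + _; set z := p%:R + _ + _ => z0 y0.
  rewrite factS natrM exprS !expr_div_n.
  have f0 : p`!%:R != 0 :> R by rewrite pnatr_eq0 -lt0n fact_gt0.
  have p0 : p.+1%:R != 0 :> R by rewrite pnatr_eq0.
  by field; rewrite nat1r p0 f0 lprod_neq0 ?expf_neq0.
have -> : (p%:R * q)%:C = p%:R * q%:C by rewrite rmorphM rmorph_nat.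
by ring.
Qed.

(** Inversion leaves [coefB m p], whose factors p! and l^p and powers of a+m and a+m+p cancel
    against the normalisation of H. *)
Lemma polyH_0 p m : polyH a q L w 0 p m = cpow w a / (a ^+ k)%:C.
Proof.
rewrite polyH_transform.
rewrite (eq_stirling1_transform _ _ _ _ p (fun i => polyB_transform i m)).
rewrite stirling_inversion /coefB.
have a0 : a != 0 by have := haj 0; rewrite addr0.
have f0 : p`!%:R != 0 :> R by rewrite pnatr_eq0 -lt0n fact_gt0.
have -> : a + m%:R + p%:R = p%:R + a + m%:R by ring.
have y0 := shift_neq0 p m; have z0 := haj m.
(* Gathering every real factor under one embedding isolates the complex l^a and reduces the
   cancellation to a field identity in [R]. *)
have real_part (c d e l z : R) (W : R[i]) :
    c%:C * (d%:C * (e%:C * (W * l%:C) / z%:C)) = W * (c * d * e * l / z)%:C.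
  by rewrite !rmorphM fmorphV /=; ring.
rewrite real_part -fmorphV /=; congr (_ * _%:C); rewrite !expr_div_n.
by field; rewrite ?expf_neq0 ?f0 ?z0 ?y0 ?a0 ?lprod_neq0.
Qed.

End PolyBernoulli.

Theorem theorem7 (R : realType) (k : nat) (a q : R) (L : 'I_k -> R) (w : R[i])
    (hk : (1 <= k)%N) (ha : a != 0) (hq : q != 0)
    (hL : forall i : 'I_k, L i != 0)
    (haj : forall j : nat, a + j%:R != 0)
    (hw : cexp w = (lprod L)%:C) :
  (forall n p m : nat,
     polyH a q L w n.+1 p m =
       (lprod L * p.+1%:R * (p%:R + a + m%:R) ^+ k
          / (p%:R + a + m%:R + 1) ^+ k)%:C * polyH a q L w n p.+1 m
       - (p%:R * q)%:C * polyH a q L w n p m) /\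
  (forall p m : nat,
     polyH a q L w 0 p m = cpow w a / (a ^+ k)%:C).
Proof.
have l0 : lprod L != 0 by apply/prodf_neq0 => i _; exact: hL.
by split=> [n p m|p m]; [exact: polyH_rec | exact: polyH_0].
Qed.
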